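(* Let $(R,\mathfrak{m})$ be an excellent, Cohen-Macaulay local domain of prime characteristic $p>0$ and dimension $d$, let $\mathfrak{a}\subset R$ be an ideal of positive height, and let $t\in\mathbb{R}_{>0}$. Then $(R,\mathfrak{a}^t)$ is $F$-nilpotent if and only if $0^{*\mathfrak{a}^t}_{H^d_{\mathfrak{m}}(R)}=0^F_{H^d_{\mathfrak{m}}(R)}$.
   Context: $R^\circ=R\setminus\{0\}$ for a domain $R$. $I^{[p^e]}$ is the ideal generated by $\{r^{p^e}\mid r\in I\}$. For an ideal $I$, $I^F=\{x\in R\mid x^{p^e}\in I^{[p^e]}\text{ for some }e\in\mathbb{N}\}$ and $$I^{*\mathfrak{a}^t}=\{x\in R\mid\text{for some }c\in R^\circ\text{ and all }e\gg0,\ cx^{p^e}\mathfrak{a}^{\lceil tp^e\rceil}\subset I^{[p^e]}\}.$$ For an excellent, equidimensional, reduced local ring $R$ and an ideal $\mathfrak{a}$ of positive height, the pair $(R,\mathfrak{a}^t)$ is called $F$-nilpotent if $\mathfrak{q}^{*\mathfrak{a}^t}=\mathfrak{q}^F$ for all ideals $\mathfrak{q}\subset R$ generated by a (full) system of parameters for $R$. Let $F:H^d_{\mathfrak{m}}(R)\to H^d_{\mathfrak{m}}(R)$ be the canonical Frobenius action on the top local cohomology module, with $e$-th iterate $F^e$. Then $$0^{*\mathfrak{a}^t}_{H^d_{\mathfrak{m}}(R)}=\{\xi\in H^d_{\mathfrak{m}}(R)\mid\text{there is }c\in R^\circ\text{ such that for all }e\gg0,\ c\,\mathfrak{a}^{\lceil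 tp^e\rceil}F^e(\xi)=0\},$$ $$0^F_{H^d_{\mathfrak{m}}(R)}=\{\xi\in H^d_{\mathfrak{m}}(R)\mid F^e(\xi)=0\text{ for some }e\in\mathbb{N}\}.$$ *)

(* Defs.v *)
From HB Require Import structures.
From mathcomp Require Import all_boot all_order all_algebra ring.
From mathcomp Require Import boolp classical_sets reals.

Set Implicit Arguments.
Unset Strict Implicit.
Unset Printing Implicit Defensive.

Import Order.TTheory GRing.Theory Num.Theory.
Local Open Scope classical_set_scope.
Local Open Scope ring_scope.
Local Open Scope quotient_scope.

(* Rings may be zero ([comPzRingType]), because localizations and tensor
   products can be. *)

Section Ideals.
Variable A : comPzRingType.
Implicit Types (I J P m : set A).

Definition is_ideal I : Prop :=
  [/\ I 0, forall x y, I x -> I y -> I (x + y) & forall a x, I x -> I (a * x)].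

Definition prime_ideal P : Prop :=
  [/\ is_ideal P, ~ P 1 & forall x y, P (x * y) -> P x \/ P y].

Definition maximal_ideal m : Prop :=
  [/\ is_ideal m, ~ m 1 &
      forall J, is_ideal J -> ~ J 1 -> m `<=` J -> J = m].

Definition local_ring m : Prop :=
  maximal_ideal m /\ forall n, maximal_ideal n -> n = m.

Definition ideal_gen (S : set A) : set A := smallest is_ideal S.

Definition noetherian : Prop :=
  forall I, is_ideal I -> exists s : seq A, I = ideal_gen [set` s].

Definition ideal_mul I J : set A :=
  ideal_gen [set z | exists x y, [/\ I x, J y & z = x * y]].

Fixpoint ideal_exp I (n : nat) : set A :=
  if n is k.+1 then ideal_mul I (ideal_exp I k) else setT.

(* [frobenius_power I (p ^ e)] is I^{[p^e]} *)
Definition frobenius_power I (q : nat) : set A :=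
  ideal_gen [set r ^+ q | r in I].

(* C 0, ..., C n is a strictly increasing chain of n + 1 primes; the values of
   C beyond n are irrelevant *)
Definition prime_chain (n : nat) (C : nat -> set A) : Prop :=
  (forall i, (i <= n)%N -> prime_ideal (C i)) /\
  (forall i, (i < n)%N -> C i `<` C i.+1).

Definition krull_dim (d : nat) : Prop :=
  (exists C, prime_chain d C) /\
  (forall n C, prime_chain n C -> (n <= d)%N).

(* ht I = inf of the heights of the primes containing I (infinite if I = A) *)
Definition height_ge I (n : nat) : Prop :=
  forall Q, prime_ideal Q -> I `<=` Q ->
    exists C, prime_chain n C /\ C n = Q.

Definition system_of_parameters m (d : nat) (x : 'I_d -> A) : Prop :=
  [/\ krull_dim d, forall i, m (x i) &
      forall y, m y -> exists n : nat, ideal_gen (range x) (y ^+ n)].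

Definition regular_sequence (s : seq A) : Prop :=
  ~ ideal_gen [set` s] 1 /\
  forall i, (i < size s)%N -> forall y,
    ideal_gen [set` take i s] (s`_i * y) -> ideal_gen [set` take i s] y.

Definition is_depth m (n : nat) : Prop :=
  (exists s, [/\ regular_sequence s, [set` s] `<=` m & size s = n]) /\
  (forall s, regular_sequence s -> [set` s] `<=` m -> (size s <= n)%N).

(* depth = dim, for a Noetherian local ring with maximal ideal m *)
Definition cohen_macaulay m : Prop :=
  exists d, krull_dim d /\ is_depth m d.

Definition regular_local : Prop :=
  noetherian /\
  exists m d, [/\ local_ring m, krull_dim d &
    exists x : 'I_d -> A, m = ideal_gen (range x)].

Definition saturated_chain (n : nat) (C : nat -> set A) P Q : Prop :=
  [/\ prime_chain n C, C 0%N = P, C n = Q &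
      forall i, (i < n)%N -> forall P', prime_ideal P' ->
        C i `<=` P' -> P' `<=` C i.+1 -> P' = C i \/ P' = C i.+1].

Definition catenary : Prop :=
  forall P Q, prime_ideal P -> prime_ideal Q -> P `<=` Q ->
    exists n, (exists C, saturated_chain n C P Q) /\
              (forall k C, saturated_chain k C P Q -> k = n).

End Ideals.

Record mulset (A : comPzRingType) := MulSet {
  mulset_set : set A;
  mulset1 : mulset_set 1;
  mulsetM : forall s t, mulset_set s -> mulset_set t -> mulset_set (s * t) }.

Section Localization.
Variables (A : comPzRingType) (M : mulset A).

Definition fracrep := (A * set_type (mulset_set M))%type.

Lemma mulset_val (s : set_type (mulset_set M)) : mulset_set M (val s).
Proof. exact: set_mem (valP s). Qed.

Definition mkden (s : A) (Ms : mulset_set M s) : set_type (mulset_set M) := SigSub (mem_set Ms).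

Definition fraceq (u v : fracrep) : bool :=
  `[< exists2 w, mulset_set M w & w * (u.1 * val v.2) = w * (v.1 * val u.2) >].

Lemma fraceq_equiv : equiv_class_of fraceq.
Proof.
split.
- by move=> u; apply/asboolP; exists 1 => //; exact: mulset1.
- by move=> u v; apply/asboolP/asboolP => -[w Mw e]; exists w.
- move=> v u w /asboolP[a Ma ea] /asboolP[b Mb eb]; apply/asboolP.
  exists (a * b * val v.2).
    by apply: mulsetM (mulset_val _); exact: mulsetM.
  have -> : a * b * val v.2 * (u.1 * val w.2)
          = b * val w.2 * (a * (u.1 * val v.2)) by ring.
  rewrite ea.
  have -> : b * val w.2 * (a * (v.1 * val u.2))
          = a * val u.2 * (b * (v.1 * val w.2)) by ring.
  by rewrite eb; ring.
Qed.

Canonical fraceq_equivrel := EquivRelPack fraceq_equiv.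
Canonical fraceq_encModRel := defaultEncModRel fraceq.

Definition loc := {eq_quot fraceq}.
HB.instance Definition _ := Choice.on loc.
HB.instance Definition _ : EqQuotient fracrep fraceq loc := EqQuotient.on loc.

Definition mulden (s t : set_type (mulset_set M)) : set_type (mulset_set M) :=
  mkden (mulsetM (mulset_val s) (mulset_val t)).

Definition frac (a : A) (s : set_type (mulset_set M)) : loc := \pi_loc (a, s).

Lemma fracP a s b t :
  frac a s = frac b t <->
  exists2 w, mulset_set M w & w * (a * val t) = w * (b * val s).
Proof.
rewrite /frac; split; first by move/eqmodP => /asboolP.
by move=> h; apply/eqmodP/asboolP.
Qed.

Lemma frac_eq a s b t : a * val t = b * val s -> frac a s = frac b t.
Proof. by move=> e; apply/fracP; exists 1; [exact: mulset1 | rewrite e]. Qed.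

Lemma fracE (u : loc) : exists a s, u = frac a s.
Proof. by exists (repr u).1, (repr u).2; rewrite /frac -surjective_pairing reprK. Qed.

Lemma repr_frac a s :
  exists2 w, mulset_set M w & w * ((repr (frac a s)).1 * val s)
                 = w * (a * val (repr (frac a s)).2).
Proof. by apply/fracP; rewrite /frac -surjective_pairing reprK. Qed.

Let den1 : set_type (mulset_set M) := mkden (mulset1 M).

Lemma val_den1 : val den1 = 1. Proof. by []. Qed.
Lemma val_mulden s t : val (mulden s t) = val s * val t. Proof. by []. Qed.
Let denE := (val_den1, val_mulden).

Definition loc_zero : loc := frac 0 den1.
Definition loc_one : loc := frac 1 den1.
Definition loc_opp (u : loc) : loc := frac (- (repr u).1) (repr u).2.
Definition loc_add (u v : loc) : loc :=
  frac ((repr u).1 * val (repr v).2 + (repr v).1 * val (repr u).2)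
       (mulden (repr u).2 (repr v).2).
Definition loc_mul (u v : loc) : loc :=
  frac ((repr u).1 * (repr v).1) (mulden (repr u).2 (repr v).2).

Lemma loc_oppE a s : loc_opp (frac a s) = frac (- a) s.
Proof.
have [w Mw e] := repr_frac a s; apply/fracP; exists w => //.
by rewrite !mulNr !mulrN e.
Qed.

Lemma loc_addE a s b t :
  loc_add (frac a s) (frac b t) = frac (a * val t + b * val s) (mulden s t).
Proof.
have [w Mw e] := repr_frac a s; have [z Mz f] := repr_frac b t.
apply/fracP; exists (w * z); first exact: mulsetM.
rewrite !val_mulden; set r := repr (frac a s) in e *; set r' := repr (frac b t) in f *.
transitivity (z * val r'.2 * val t * (w * (r.1 * val s))
              + w * val r.2 * val s * (z * (r'.1 * val t))); first by ring.
by rewrite e f; ring.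
Qed.

Lemma loc_mulE a s b t :
  loc_mul (frac a s) (frac b t) = frac (a * b) (mulden s t).
Proof.
have [w Mw e] := repr_frac a s; have [z Mz f] := repr_frac b t.
apply/fracP; exists (w * z); first exact: mulsetM.
rewrite !val_mulden; set r := repr (frac a s) in e *; set r' := repr (frac b t) in f *.
transitivity ((w * (r.1 * val s)) * (z * (r'.1 * val t))); first by ring.
by rewrite e f; ring.
Qed.

Lemma loc_addA : associative loc_add.
Proof.
move=> u v w; have [a [s ->]] := fracE u; have [b [t ->]] := fracE v.
by have [c [r ->]] := fracE w; rewrite !loc_addE; apply: frac_eq; rewrite ?denE; ring.
Qed.

Lemma loc_addC : commutative loc_add.
Proof.
move=> u v; have [a [s ->]] := fracE u; have [b [t ->]] := fracE v.
by rewrite !loc_addE; apply: frac_eq; rewrite ?denE; ring.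
Qed.

Lemma loc_add0 : left_id loc_zero loc_add.
Proof.
by move=> u; have [a [s ->]] := fracE u; rewrite loc_addE; apply: frac_eq; rewrite ?denE; ring.
Qed.

Lemma loc_addN : left_inverse loc_zero loc_opp loc_add.
Proof.
move=> u; have [a [s ->]] := fracE u.
by rewrite loc_oppE loc_addE; apply: frac_eq; rewrite ?denE; ring.
Qed.

HB.instance Definition _ :=
  GRing.isZmodule.Build loc loc_addA loc_addC loc_add0 loc_addN.

Lemma loc_mulA : associative loc_mul.
Proof.
move=> u v w; have [a [s ->]] := fracE u; have [b [t ->]] := fracE v.
by have [c [r ->]] := fracE w; rewrite !loc_mulE; apply: frac_eq; rewrite ?denE; ring.
Qed.

Lemma loc_mulC : commutative loc_mul.
Proof.
move=> u v; have [a [s ->]] := fracE u; have [b [t ->]] := fracE v.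
by rewrite !loc_mulE; apply: frac_eq; rewrite ?denE; ring.
Qed.

Lemma loc_mul1 : left_id loc_one loc_mul.
Proof.
by move=> u; have [a [s ->]] := fracE u; rewrite loc_mulE; apply: frac_eq; rewrite ?denE; ring.
Qed.

Lemma loc_mulDl : left_distributive loc_mul loc_add.
Proof.
move=> u v w; have [a [s ->]] := fracE u; have [b [t ->]] := fracE v.
have [c [r ->]] := fracE w.
by rewrite !(loc_mulE, loc_addE); apply: frac_eq; rewrite ?denE; ring.
Qed.

HB.instance Definition _ :=
  GRing.Zmodule_isComPzRing.Build loc loc_mulA loc_mulC loc_mul1 loc_mulDl.

Definition loc_map (a : A) : loc := frac a den1.

Lemma loc_map_zmod : zmod_morphism loc_map.
Proof.
move=> a b; rewrite [RHS](_ : _ = loc_add (loc_map a) (loc_opp (loc_map b))) //.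
by rewrite loc_oppE loc_addE; apply: frac_eq; rewrite ?denE; ring.
Qed.

Lemma loc_map_monoid : monoid_morphism loc_map.
Proof.
split=> // a b; rewrite [RHS](_ : _ = loc_mul (loc_map a) (loc_map b)) //.
by rewrite loc_mulE; apply: frac_eq; rewrite ?denE; ring.
Qed.

HB.instance Definition _ := GRing.isZmodMorphism.Build A loc loc_map loc_map_zmod.
HB.instance Definition _ := GRing.isMonoidMorphism.Build A loc loc_map loc_map_monoid.

Definition loc_scale (a : A) (u : loc) : loc := loc_map a * u.

Lemma loc_scaleA a b u : loc_scale a (loc_scale b u) = loc_scale (a * b) u.
Proof. by rewrite /loc_scale rmorphM mulrA. Qed.
Lemma loc_scale1 : left_id 1 loc_scale.
Proof. by move=> u; rewrite /loc_scale rmorph1 mul1r. Qed.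
Lemma loc_scaleDr : right_distributive loc_scale +%R.
Proof. by move=> a u v; rewrite /loc_scale mulrDr. Qed.
Lemma loc_scaleDl u : {morph loc_scale^~ u : a b / a + b}.
Proof. by move=> a b; rewrite /loc_scale rmorphD mulrDl. Qed.

HB.instance Definition _ := GRing.Zmodule_isLmodule.Build A loc
  loc_scaleA loc_scale1 loc_scaleDr loc_scaleDl.

End Localization.

Lemma powers1 (A : comPzRingType) (f : A) : range (fun n : nat => f ^+ n) 1.
Proof. by exists 0%N. Qed.

Lemma powersM (A : comPzRingType) (f : A) s t :
  range (fun n : nat => f ^+ n) s -> range (fun n : nat => f ^+ n) t ->
  range (fun n : nat => f ^+ n) (s * t).
Proof. by move=> [i _ <-] [j _ <-]; exists (i + j)%N; rewrite // exprD. Qed.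

Definition powers (A : comPzRingType) (f : A) : mulset A :=
  MulSet (powers1 f) (@powersM A f).

Lemma prime_compl1 (A : comPzRingType) (P : set A) :
  prime_ideal P -> (~` P) 1.
Proof. by case. Qed.

Lemma prime_complM (A : comPzRingType) (P : set A) :
  prime_ideal P -> forall s t, (~` P) s -> (~` P) t -> (~` P) (s * t).
Proof. by move=> [_ _ PM] s t Ps Pt /PM[]. Qed.

Definition prime_compl (A : comPzRingType) (P : set A) (hP : prime_ideal P) :
  mulset A := MulSet (prime_compl1 hP) (prime_complM hP).

Definition regular_ring (A : comPzRingType) : Prop :=
  noetherian A /\
  forall (P : set A) (hP : prime_ideal P), regular_local (loc (prime_compl hP)).

Definition finite_type (A B : comPzRingType) (phi : {rmorphism A -> B}) : Prop :=
  exists s : seq B, forall D : set B,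
    (forall a, D (phi a)) -> [set` s] `<=` D ->
    (forall x y, D x -> D y -> D (x + y)) ->
    (forall x y, D x -> D y -> D (x * y)) ->
    D = setT.

Definition universally_catenary (A : comPzRingType) : Prop :=
  forall (B : comPzRingType) (phi : {rmorphism A -> B}),
    finite_type phi -> catenary B.

Definition regular_locus_open (A : comPzRingType) : Prop :=
  exists J : set A, is_ideal J /\
    forall (P : set A) (hP : prime_ideal P),
      regular_local (loc (prime_compl hP)) <-> ~ (J `<=` P).

Definition J2_ring (A : comPzRingType) : Prop :=
  forall (B : comPzRingType) (phi : {rmorphism A -> B}),
    finite_type phi -> regular_locus_open B.

(* g exhibits C as lim_n A/m^n, for m finitely generated: the four clauses say
   that A/m^n -> C/m^nC is injective and surjective for all n, and that C is
   m-adically separated and complete *)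
Definition is_completion (A C : comPzRingType) (m : set A)
    (g : {rmorphism A -> C}) : Prop :=
  let J n := ideal_gen (g @` ideal_exp m n) in
  [/\ forall n a, J n (g a) -> ideal_exp m n a,
      forall n c, exists a, J n (c - g a),
      forall c, (forall n, J n c) -> c = 0 &
      forall a : nat -> A, (forall n, ideal_exp m n (a n.+1 - a n)) ->
        exists c, forall n, J n (c - g (a n))].

(* k is the fraction field of A/Q *)
Definition is_residue_field (A : comPzRingType) (Q : set A) (k : fieldType)
    (phi : {rmorphism A -> k}) : Prop :=
  (forall a, Q a <-> phi a = 0) /\
  (forall z, exists a s, phi s != 0 /\ z = phi a / phi s).

(* T = B (x)_A C, as the pushout of commutative rings *)
Definition is_tensor (A B C T : comPzRingType)
    (f : {rmorphism A -> B}) (g : {rmorphism A -> C})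
    (i : {rmorphism B -> T}) (j : {rmorphism C -> T}) : Prop :=
  (forall a, i (f a) = j (g a)) /\
  forall (D : comPzRingType) (u : {rmorphism B -> D}) (v : {rmorphism C -> D}),
    (forall a, u (f a) = v (g a)) ->
    exists h : {rmorphism T -> D},
      [/\ forall b, h (i b) = u b, forall c, h (j c) = v c &
          forall h' : {rmorphism T -> D},
            (forall b, h' (i b) = u b) -> (forall c, h' (j c) = v c) ->
            forall z, h' z = h z].

Definition finite_extension (k L : fieldType) (psi : {rmorphism k -> L}) : Prop :=
  exists (n : nat) (l : 'I_n -> L), forall z,
    exists c : 'I_n -> k, z = \sum_i psi (c i) * l i.

Definition geometrically_regular (k : fieldType) (B : comPzRingType)
    (f : {rmorphism k -> B}) : Prop :=
  forall (L : fieldType) (psi : {rmorphism k -> L}), finite_extension psi ->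
  forall (T : comPzRingType) (i : {rmorphism B -> T}) (j : {rmorphism L -> T}),
    is_tensor f psi i j -> regular_ring T.

Definition geometrically_regular_formal_fibers (A : comPzRingType) (m : set A) :
  Prop :=
  forall (C : comPzRingType) (g : {rmorphism A -> C}), is_completion m g ->
  forall (Q : set A), prime_ideal Q ->
  forall (k : fieldType) (phi : {rmorphism A -> k}), is_residue_field Q phi ->
  forall (B : comPzRingType) (i : {rmorphism C -> B}) (j : {rmorphism k -> B}),
    is_tensor g phi i j -> geometrically_regular j.

Definition G_ring (A : comPzRingType) : Prop :=
  forall (P : set A) (hP : prime_ideal P) (n : set (loc (prime_compl hP))),
    local_ring n -> geometrically_regular_formal_fibers n.

Definition excellent (A : comPzRingType) : Prop :=
  [/\ noetherian A, universally_catenary A, G_ring A & J2_ring A].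

(* [loccoh x] is the top Cech cohomology on x_1, ..., x_d, i.e. the cokernel of
   (+)_i A_{x_1...^x_i...x_d} -> A_{x_1...x_d}.  For a system of parameters x of
   a Noetherian local ring (A, m) this is H^d_m(A). *)

Section Cech.
Variables (A : comPzRingType) (d : nat) (x : 'I_d -> A).

Definition cech_top := loc (powers (\prod_i x i)).

(* the image of A_{f_i} in A_{x_1...x_d}, where f_i = \prod_(j != i) x_j acts
   invertibly: the elements a / f_i^n *)
Definition cech_face (i : 'I_d) : set cech_top :=
  [set u | exists (n : nat) (a : A),
     (\prod_(j | j != i) x j) ^+ n *: u = loc_map (powers (\prod_i x i)) a].

Definition cech_boundary : set cech_top :=
  [set u | exists v : 'I_d -> cech_top,
     (forall i, cech_face i (v i)) /\ u = \sum_i v i].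

Definition cech_boundaryb : {pred cech_top} := fun u => `[< cech_boundary u >].

Lemma cech_face_zmod i : cech_face i 0 /\
  forall u v, cech_face i u -> cech_face i v -> cech_face i (u - v).
Proof.
split; first by exists 0%N, 0; rewrite scaler0 rmorph0.
move=> u v [n [a ea]] [k [b eb]].
set f := \prod_(j | j != i) x j in ea eb *.
exists (n + k)%N, (f ^+ k * a - f ^+ n * b).
rewrite scalerBr exprD -[in X in _ - X]scalerA eb mulrC -scalerA ea.
by rewrite rmorphB !rmorphM.
Qed.

Lemma cech_faceZ i a u : cech_face i u -> cech_face i (a *: u).
Proof.
move=> [n [b e]]; exists n, (a * b).
by rewrite scalerA mulrC -scalerA e rmorphM.
Qed.

Lemma cech_boundary_zmod : zmod_closed cech_boundaryb.
Proof.
split.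
  apply/asboolP; exists (fun=> 0); split; last by rewrite big1_eq.
  by move=> i; case: (cech_face_zmod i).
move=> u v /asboolP[u' [hu ->]] /asboolP[v' [hv ->]]; apply/asboolP.
exists (fun i => u' i - v' i); split; last by rewrite sumrB.
by move=> i; apply: (cech_face_zmod i).2.
Qed.

HB.instance Definition _ :=
  GRing.isZmodClosed.Build cech_top cech_boundaryb cech_boundary_zmod.

Definition loccoh := Quotient.quot cech_boundaryb.
HB.instance Definition _ := GRing.Zmodule.on loccoh.

Definition cech_class (u : cech_top) : loccoh := \pi_loccoh u.

Lemma cech_classK (xi : loccoh) : cech_class (repr xi) = xi.
Proof. exact: reprK. Qed.

Lemma cech_classP u v : cech_class u = cech_class v <-> cech_boundary (u - v).
Proof.
split; first by move/eqP; rewrite -Quotient.idealrBE => /asboolP.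
by move=> h; apply/eqP; rewrite -Quotient.idealrBE; apply/asboolP.
Qed.

Lemma cech_class_zmod : zmod_morphism cech_class.
Proof. by move=> u v; rewrite /cech_class !piE. Qed.

HB.instance Definition _ :=
  GRing.isZmodMorphism.Build cech_top loccoh cech_class cech_class_zmod.

Definition loccoh_scale (a : A) (xi : loccoh) : loccoh := cech_class (a *: repr xi).

Lemma cech_boundaryZ a u : cech_boundary u -> cech_boundary (a *: u).
Proof.
move=> [v [hv ->]]; exists (fun i => a *: v i); split; last by rewrite scaler_sumr.
by move=> i; exact: cech_faceZ.
Qed.

Lemma loccoh_scaleE a u : loccoh_scale a (cech_class u) = cech_class (a *: u).
Proof.
apply/cech_classP; rewrite -scalerBr; apply: cech_boundaryZ.
by apply/cech_classP; rewrite cech_classK.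
Qed.

Lemma loccoh_scaleA a b xi :
  loccoh_scale a (loccoh_scale b xi) = loccoh_scale (a * b) xi.
Proof. by rewrite -(cech_classK xi) !loccoh_scaleE scalerA. Qed.
Lemma loccoh_scale1 : left_id 1 loccoh_scale.
Proof. by move=> xi; rewrite -(cech_classK xi) loccoh_scaleE scale1r. Qed.
Lemma loccoh_scaleDr : right_distributive loccoh_scale +%R.
Proof.
move=> a xi zt; rewrite -(cech_classK xi) -(cech_classK zt).
by rewrite -raddfD !loccoh_scaleE scalerDr raddfD.
Qed.
Lemma loccoh_scaleDl xi : {morph loccoh_scale^~ xi : a b / a + b}.
Proof.
by move=> a b; rewrite -(cech_classK xi) !loccoh_scaleE scalerDl raddfD.
Qed.

HB.instance Definition _ := GRing.Zmodule_isLmodule.Build A loccoh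
  loccoh_scaleA loccoh_scale1 loccoh_scaleDr loccoh_scaleDl.

Lemma cech_classZ a u : cech_class (a *: u) = a *: cech_class u.
Proof. by rewrite -loccoh_scaleE. Qed.

(* The Frobenius of A_{x_1...x_d} induces the action on the quotient; it does
   not depend on the representative by [loccoh_frobE] *)
Definition loccoh_frob (p : nat) (xi : loccoh) : loccoh :=
  cech_class (repr xi ^+ p).

End Cech.

Lemma frobD (B : comPzRingType) (p : nat) : prime p -> p%:R = 0 :> B ->
  forall u v : B, (u + v) ^+ p = u ^+ p + v ^+ p.
Proof.
move=> p_pr p0 u v; have defp := prednK (prime_gt0 p_pr).
rewrite exprDn big_ord_recr subnn -defp big_ord_recl /= subn0 expr0 mulr1 mul1r.
rewrite bin0 binn !mulr1n big1 ?addr0 // => i _.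
have /dvdnP[k ->] : (p %| 'C(p.-1.+1, bump 0 i))%N.
  by rewrite defp prime_dvd_bin //= -{2}defp ltnS (valP i).
by rewrite mulrnA -mulr_natr p0 mulr0.
Qed.

Section Frobenius.
Variables (A : comNzRingType) (d : nat) (x : 'I_d -> A) (p : nat).
Hypothesis charAp : p \in [pchar A].

Lemma cech_frobD (u v : cech_top x) : (u + v) ^+ p = u ^+ p + v ^+ p.
Proof.
apply: frobD; first exact: pcharf_prime charAp.
have := rmorph_nat (loc_map (powers (\prod_i x i))) p.
by rewrite (pcharf0 charAp) rmorph0.
Qed.

Lemma cech_boundary_frob (u : cech_top x) :
  cech_boundary u -> cech_boundary (u ^+ p).
Proof.
move=> [v [hv ->]]; exists (fun i => v i ^+ p); split.
  move=> i; have [n [a e]] := hv i; exists (n * p)%N, (a ^+ p).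
  rewrite [RHS]rmorphXn /= -e exprM.
  rewrite -[LHS]/(loc_map _ _ * _) -[X in _ = X ^+ _]/(loc_map _ _ * _) rmorphXn.
  by rewrite exprMn.
have p0 : (0 : cech_top x) ^+ p = 0.
  by rewrite expr0n gtn_eqF // prime_gt0 // (pcharf_prime charAp).
by apply: (big_morph (fun u : cech_top x => u ^+ p)) => //; exact: cech_frobD.
Qed.

Lemma loccoh_frobE (u : cech_top x) :
  loccoh_frob p (cech_class u) = cech_class (u ^+ p).
Proof.
apply/cech_classP; set r := repr _.
have -> : r ^+ p - u ^+ p = (r - u) ^+ p.
  by apply/eqP; rewrite subr_eq -cech_frobD subrK.
by apply: cech_boundary_frob; apply/cech_classP; rewrite cech_classK.
Qed.

End Frobenius.

Section FNilpotent.
Variables (K : realType) (R : idomainType) (p : nat).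
Implicit Types (m a I : set R) (t : K).

(* for t > 0 the ceiling is nonnegative, so [absz] only casts it to nat *)
Definition ceil_exp t (e : nat) : nat := absz (Num.ceil (t * (p ^ e)%:R)).

Definition tight_closure a t I : set R :=
  [set x | exists2 c, c != 0 & exists e0 : nat, forall e, (e0 <= e)%N ->
     forall y, ideal_exp a (ceil_exp t e) y ->
       frobenius_power I (p ^ e) (c * x ^+ (p ^ e) * y)].

Definition frobenius_closure I : set R :=
  [set x | exists e : nat, frobenius_power I (p ^ e) (x ^+ (p ^ e))].

(* for an excellent local domain (R, m) and an ideal a of positive height;
   a domain is reduced and equidimensional *)
Definition F_nilpotent m a t : Prop :=
  forall (d : nat) (x : 'I_d -> R), system_of_parameters m x ->
    tight_closure a t (ideal_gen (range x)) =
    frobenius_closure (ideal_gen (range x)).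

Definition loccoh_tight_closure0 (d : nat) (x : 'I_d -> R) a t :
    set (loccoh x) :=
  [set xi | exists2 c : R, c != 0 & exists e0 : nat, forall e, (e0 <= e)%N ->
     forall y, ideal_exp a (ceil_exp t e) y ->
       (c * y) *: iter e (loccoh_frob p) xi = 0].

Definition loccoh_frobenius_closure0 (d : nat) (x : 'I_d -> R) :
    set (loccoh x) :=
  [set xi | exists e : nat, iter e (loccoh_frob p) xi = 0].

End FNilpotent.

Arguments loccoh_tight_closure0 {K R} p {d} x a t.
Arguments loccoh_frobenius_closure0 {R} p {d} x.

(* Main.v *)
From HB Require Import structures.
Require Import Defs.
From mathcomp Require Import all_boot all_order all_algebra ring.
From mathcomp Require Import boolp classical_sets reals.

(** Write q = p^e.  Both closures are read off, for each e, from one vanishing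
    condition, and the theorem says that the two conditions match.

    Let x be a system of parameters.  Every class in the top local cohomology
    is that of some b / (x_1...x_d)^n with n > 0, and F^e sends it to the
    class of b^q / (x_1...x_d)^(nq).  In a Cohen-Macaulay ring the class of
    b / (x_1...x_d)^n vanishes exactly when b lies in (x_1^n, ..., x_d^n)
    ([cech_class_frac0]).  So c F^e kills the class of b / (x_1...x_d)^n
    exactly when c b^q lies in the q-th Frobenius power of (x_1^n, ..., x_d^n):
    the closures of 0 in the cohomology know the closures of the parameter
    ideals (x_1^n, ..., x_d^n), and conversely, as x_1^n, ..., x_d^n is again a
    system of parameters.

    F-nilpotence involves all systems of parameters y, while the cohomology is
    computed from one x.  Some powers satisfy x_i^n = sum_j C_ij y_j, and
    b |-> det(C) b / (x_1...x_d)^n identifies R/(y) with a submodule of the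
    cohomology, compatibly with Frobenius because
    x_i^(nq) = sum_j C_ij^q y_j^q ([frobenius_power_frac]).

    Both injectivity claims are cases of [parameter_det_colon]: if z = C y and
    some power of every element of m lies in (z), then det(C) b in (z) forces
    b in (y).  A ring of dimension and depth d has a regular sequence of length
    d, whose powers stay regular ([weakly_regular_exp]) and eventually lie in
    (z); composing the two matrices and using the multiplicativity of the
    determinant, z may be replaced by a regular sequence s.  For s = C y regular
    the claim holds in every commutative ring ([regular_det_colon]), by a
    descent in the Koszul complex of y.  The wedge w_k of the first k rows of C
    satisfies d(w_k) = s_k w_(k-1) modulo (s_1, ..., s_(k-1)), and w_d is
    det(C) times the top form.  If b w_k is a boundary modulo (s_1, ..., s_k),
    then applying d and cancelling s_k makes b w_(k-1) a boundary modulo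
    (s_1, ..., s_(k-1)).  One starts from det(C) b in (s); at k = 0 the scalar b
    itself is a boundary, that is, an element of (y). *)

Set Implicit Arguments.
Unset Strict Implicit.
Unset Printing Implicit Defensive.

Import GRing.Theory.
Local Open Scope classical_set_scope.
Local Open Scope ring_scope.

(** * Ideals and weakly regular sequences *)

Section Ideals.
Variable A : comPzRingType.
Implicit Types (I J : set A) (z : A).

Lemma ideal_sum I (n : nat) (f : 'I_n -> A) :
  is_ideal I -> (forall i, I (f i)) -> I (\sum_i f i).
Proof. by move=> [I0 ID _] If; apply: big_ind. Qed.

Lemma idealN I z : is_ideal I -> I z -> I (- z).
Proof. by move=> [_ _ IM] Iz; rewrite -mulN1r; apply: IM. Qed.

Lemma idealB I z z' : is_ideal I -> I z -> I z' -> I (z - z').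
Proof.
by move=> idI Iz Iz'; case: (idI) => _ ID _; apply: ID => //; apply: idealN.
Qed.

Lemma ideal_gen_ideal (S : set A) : is_ideal (ideal_gen S).
Proof.
split.
- by move=> I [[]].
- by move=> u v Iu Iv I IS; case: (IS) => -[_ ID _] _; apply: ID; [apply: Iu|apply: Iv].
- by move=> a u Iu I IS; case: (IS) => -[_ _ IM] _; apply: IM; apply: Iu.
Qed.

Lemma ideal_gen_sub (S : set A) I : is_ideal I -> S `<=` I -> ideal_gen S `<=` I.
Proof. by move=> idI SI z; apply. Qed.

Lemma mem_ideal_gen (S : set A) z : S z -> ideal_gen S z.
Proof. by move=> Sz I [_]; apply. Qed.

Lemma ideal_gen_rangeP (d : nat) (x : 'I_d -> A) z :
  ideal_gen (range x) z <-> exists c : 'I_d -> A, z = \sum_i c i * x i.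
Proof.
split=> [|[c ->]]; last first.
  have idI := ideal_gen_ideal (range x).
  apply: ideal_sum => // i; case: (idI) => _ _; apply.
  by apply: mem_ideal_gen; exists i.
move: z; apply: ideal_gen_sub; last first.
  move=> _ [i _ <-]; exists (fun j => (j == i)%:R).
  rewrite (bigD1 i) //= eqxx mul1r big1 ?addr0 // => j /negPf->.
  by rewrite mul0r.
split.
- by exists (fun=> 0); rewrite big1 // => i _; rewrite mul0r.
- move=> _ _ [c ->] [c' ->]; exists (fun i => c i + c' i).
  by rewrite -big_split; apply: eq_bigr => i _; rewrite mulrDl.
- move=> a _ [c ->]; exists (fun i => a * c i).
  by rewrite mulr_sumr; apply: eq_bigr => i _; rewrite mulrA.
Qed.

(** The ideal J + (t), in a form that is an ideal only when J is; membership
    comes with an explicit coefficient of t. *)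
Definition adjoin J t : set A := [set z | exists r, J (z - t * r)].

Lemma adjoin_ideal J t : is_ideal J -> is_ideal (adjoin J t).
Proof.
move=> idJ; have [J0 JD JM] := idJ; split.
- by exists 0; rewrite mulr0 subr0.
- move=> u v [r Jr] [r' Jr']; exists (r + r').
  by rewrite mulrDr opprD addrACA; apply: JD.
- by move=> a u [r Jr]; exists (a * r); rewrite mulrCA -mulrBr; apply: JM.
Qed.

Lemma adjoin_sub J t : J `<=` adjoin J t.
Proof. by move=> z Jz; exists 0; rewrite mulr0 subr0. Qed.

Lemma adjoin_self J t : is_ideal J -> adjoin J t t.
Proof. by move=> [J0 _ _]; exists 1; rewrite mulr1 subrr. Qed.

Lemma adjoin_min J t I : is_ideal I -> J `<=` I -> I t -> adjoin J t `<=` I.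
Proof.
move=> [_ ID IM] JI It z [r Jr]; rewrite -(subrK (t * r) z).
by apply: ID; [apply: JI|rewrite mulrC; apply: IM].
Qed.

Lemma adjoin_ideal_gen (l : seq A) t :
  adjoin (ideal_gen [set` l]) t = ideal_gen [set` rcons l t].
Proof.
apply/seteqP; split.
  apply: adjoin_min; first exact: ideal_gen_ideal.
    apply: ideal_gen_sub; first exact: ideal_gen_ideal.
    by move=> z /= lz; apply: mem_ideal_gen; rewrite /= mem_rcons inE lz orbT.
  by apply: mem_ideal_gen; rewrite /= mem_rcons inE eqxx.
apply: ideal_gen_sub; first by apply: adjoin_ideal; apply: ideal_gen_ideal.
move=> z /=; rewrite mem_rcons inE => /orP[/eqP->|lz].
  by apply: adjoin_self; apply: ideal_gen_ideal.
by apply: adjoin_sub; apply: mem_ideal_gen.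
Qed.

Definition nzd_mod J t := forall z, J (t * z) -> J z.

(** Regularity without properness: this form passes to extensions of quotients
    and to all powers, including those with exponent 0. *)
Fixpoint weakly_regular J (l : seq A) : Prop :=
  if l is t :: l' then nzd_mod J t /\ weakly_regular (adjoin J t) l' else True.

Lemma weakly_regular_nth J l k : weakly_regular J l -> (k < size l)%N ->
  nzd_mod (foldl adjoin J (take k l)) l`_k.
Proof. by elim: l J k => //= t l IHl J [|k] [] // _ /IHl; apply. Qed.

Lemma foldl_adjoin_ideal J l : is_ideal J -> is_ideal (foldl adjoin J l).
Proof. by elim: l J => //= t l IHl J idJ; apply/IHl/adjoin_ideal. Qed.

Lemma foldl_adjoin_sub J l : J `<=` foldl adjoin J l.
Proof.
elim: l J => [|t l IHl] J; first by [].
by apply: subset_trans (IHl (adjoin J t)); apply: adjoin_sub.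
Qed.

Lemma mem_foldl_adjoin J l t : is_ideal J -> t \in l -> foldl adjoin J l t.
Proof.
elim: l J => //= u l IHl J idJ; rewrite inE => /predU1P[->|lt].
  by apply: foldl_adjoin_sub; apply: adjoin_self.
by apply: IHl lt; apply: adjoin_ideal.
Qed.

Lemma regular_sequence_weakly (s : seq A) : regular_sequence s ->
  weakly_regular (ideal_gen [set` [::]]) s.
Proof.
move=> [_]; rewrite -[in X in X -> _](cat0s s).
elim: s [::] => //= t s IHs pre reg; split.
  move=> z; have := reg (size pre) _ z.
  rewrite take_size_cat // nth_cat ltnn subnn /= size_cat addnS ltnS leq_addr.
  exact.
rewrite adjoin_ideal_gen; apply: IHs.
by rewrite -cats1 -catA.
Qed.

(** The hypotheses say that multiplication by a gives an exact sequence
    0 -> A/J2 -> A/J -> A/J1 -> 0.  It stays exact modulo the first term of a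
    sequence that is regular on A/J1, so regularity on both ends passes to the
    middle. *)
Lemma weakly_regular_extension J J1 J2 a l :
  is_ideal J -> is_ideal J1 -> is_ideal J2 ->
  (forall z, J1 z <-> adjoin J a z) -> (forall z, J2 z <-> J (a * z)) ->
  weakly_regular J1 l -> weakly_regular J2 l -> weakly_regular J l.
Proof.
elim: l J J1 J2 => //= t l IHl J J1 J2 idJ idJ1 idJ2 J1E J2E [t1 reg1] [t2 reg2].
have [J0 JD JM] := idJ.
split.
  move=> z Jtz.
  (* z vanishes in A/J1, hence z = a z' mod J, and z' is killed by t in A/J2. *)
  have [z' Jz'] : adjoin J a z by apply/J1E/t1/J1E; apply: adjoin_sub.
  rewrite -(subrK (a * z') z); apply: JD => //; apply/J2E/t2/J2E.
  suff -> : a * (t * z') = t * z - t * (z - a * z') by apply: idealB => //; apply: JM.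
  by ring.
apply: (IHl _ _ _ _ _ _ _ _ reg1 reg2); try exact: adjoin_ideal.
  move=> z; split.
    move=> [r /J1E[r' Jr]]; exists r', r.
    by rewrite addrAC.
  by move=> [r' [r Jr]]; exists r; apply/J1E; exists r'; rewrite addrAC.
move=> z; split.
  move=> [r /J2E Jr]; exists (a * r).
  by rewrite mulrCA -mulrBr.
move=> [r Jr].
have [r' Jr'] : adjoin J a r.
  apply/J1E/t1/J1E; exists z; rewrite -opprB; exact: idealN.
exists r'; apply/J2E.
have -> : a * (z - t * r') = (a * z - t * r) + t * (r - a * r') by ring.
by apply: JD => //; apply: JM.
Qed.

Lemma weakly_regularT l : weakly_regular setT l.
Proof.
elim: l => //= t l IHl; split => //.
suff -> : adjoin setT t = setT by [].
by apply/seteqP; split=> // z _; exists 0.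
Qed.

(** Induction on n through 0 -> A/(t^n) -> A/(t^(n+1)) -> A/(t) -> 0, taken
    modulo J. *)
Lemma weakly_regular_adjoin_exp J t l n : is_ideal J -> nzd_mod J t ->
  weakly_regular (adjoin J t) l -> weakly_regular (adjoin J (t ^+ n)) l.
Proof.
move=> idJ Jt regt; elim: n => [|n IHn].
  suff -> : adjoin J (t ^+ 0) = setT by apply: weakly_regularT.
  apply/seteqP; split=> // z _; exists z.
  by rewrite mul1r subrr; case: idJ.
apply: (@weakly_regular_extension _ (adjoin J t) (adjoin J (t ^+ n)) t) => //;
  try exact: adjoin_ideal.
- move=> z; split=> [[r Jr]|[r [r' Jr]]].
    by exists r; apply: adjoin_sub.
  exists (r + t ^+ n * r'); rewrite mulrDr opprD mulrA -exprS addrA.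
  exact: Jr.
- move=> z; split=> [[r Jr]|[r Jr]]; exists r.
    by rewrite exprS -mulrA -mulrBr; case: idJ => _ _; apply.
  by apply: Jt; rewrite mulrBr mulrA -exprS.
Qed.

Lemma weakly_regular_exp J l n : is_ideal J ->
  weakly_regular J l -> weakly_regular J [seq t ^+ n | t <- l].
Proof.
elim: l J => //= t l IHl J idJ [Jt reg]; split.
  by elim: n {IHl} => [|n IHn] z; rewrite ?mul1r // exprS -mulrA => /Jt /IHn.
by apply: IHl; [apply: adjoin_ideal|apply: weakly_regular_adjoin_exp].
Qed.

End Ideals.

(** * Exterior algebra and the Koszul differential *)

Section Exterior.
Variable A : comNzRingType.
Implicit Types (c y : nat -> A).

(** The exterior algebra of A^d.  A pair (u, v) stands for u + e_d' /\ v, where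
    e_d' is the last basis vector and u, v involve only the earlier ones; this
    recursion keeps all signs local.  A vector is a function on nat of which
    ext d sees the first d values. *)
Fixpoint ext (d : nat) : lmodType A :=
  if d is d'.+1 then (ext d' * ext d')%type : lmodType A else A^o.

Fixpoint wedge (d : nat) c : ext d -> ext d :=
  if d is d'.+1 then fun w => (wedge c w.1, c d' *: w.1 - wedge c w.2)
  else fun=> 0.

(** The Koszul differential of y: the antiderivation that maps e_j to y j. *)
Fixpoint contract (d : nat) y : ext d -> ext d :=
  if d is d'.+1 then
    fun w => (contract y w.1 + y d' *: w.2, - contract y w.2)
  else fun=> 0.

Fixpoint ext_one (d : nat) : ext d :=
  if d is d'.+1 then (ext_one d', 0) else (1 : A).

Fixpoint ext_top (d : nat) : ext d :=
  if d is d'.+1 then (0, ext_top d') else (1 : A).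

Fixpoint ext_scalar (d : nat) : ext d -> A :=
  if d is d'.+1 then fun w => ext_scalar w.1 else id.

Lemma eq_pair (U V : lmodType A) (u u' : U) (v v' : V) :
  u = u' -> v = v' -> (u, v) = (u', v').
Proof. by move=> -> ->. Qed.

Lemma wedge_linear d c (k : A) (w w' : ext d) :
  wedge c (k *: w + w') = k *: wedge c w + wedge c w'.
Proof.
elim: d w w' => [|d IHd] /= w w'; first by rewrite scaler0 addr0.
apply: eq_pair; rewrite /= !IHd //.
by rewrite scalerDr scalerBr opprD addrACA !scalerA [c d * k]mulrC.
Qed.

HB.instance Definition _ d c :=
  GRing.isLinear.Build A (ext d) (ext d) *:%R (wedge c) (@wedge_linear d c).

Lemma contract_linear d c (k : A) (w w' : ext d) :
  contract c (k *: w + w') = k *: contract c w + contract c w'.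
Proof.
elim: d w w' => [|d IHd] /= w w'; first by rewrite scaler0 addr0.
apply: eq_pair; rewrite /= !IHd //.
  by rewrite !scalerDr addrACA !scalerA [c d * k]mulrC.
by rewrite scalerN opprD.
Qed.

HB.instance Definition _ d y :=
  GRing.isLinear.Build A (ext d) (ext d) *:%R (contract y) (@contract_linear d y).

Lemma wedgeD d c (w w' : ext d) : wedge c (w + w') = wedge c w + wedge c w'.
Proof. exact: raddfD. Qed.
Lemma wedgeN d c (w : ext d) : wedge c (- w) = - wedge c w.
Proof. exact: raddfN. Qed.
Lemma wedgeZ d c k (w : ext d) : wedge c (k *: w) = k *: wedge c w.
Proof. exact: linearZ. Qed.
Lemma contractB d y (w w' : ext d) :
  contract y (w - w') = contract y w - contract y w'.
Proof. exact: raddfB. Qed.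
Lemma contractD d y (w w' : ext d) :
  contract y (w + w') = contract y w + contract y w'.
Proof. exact: raddfD. Qed.
Lemma contractN d y (w : ext d) : contract y (- w) = - contract y w.
Proof. exact: raddfN. Qed.
Lemma contractZ d y k (w : ext d) : contract y (k *: w) = k *: contract y w.
Proof. exact: linearZ. Qed.

Lemma contract_contract d y (w : ext d) : contract y (contract y w) = 0.
Proof.
elim: d w => //= d IHd w; apply: eq_pair; last by rewrite contractN IHd !oppr0.
by rewrite contractD contractZ IHd add0r scalerN subrr.
Qed.

(** The anticommutation by which contracting a wedge of rows of C brings out the
    entries of C y as coefficients. *)
Lemma contract_wedge d c y (w : ext d) :
  contract y (wedge c w) = (\sum_(j < d) c j * y j) *: w - wedge c (contract y w).
Proof.
elim: d w => [|d IHd] /= w; first by rewrite big_ord0 scale0r subr0.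
rewrite big_ord_recr /=; apply: eq_pair => /=.
  rewrite IHd wedgeD wedgeZ scalerBr scalerA scalerDl.
  by rewrite [y d * c d]mulrC opprD !addrA; congr (_ + _); rewrite addrAC.
rewrite contractB contractZ IHd wedgeN scalerDr scalerDl scalerA !opprB.
by rewrite [RHS]addrACA; congr (_ + _); rewrite opprD addrCA subrr addr0.
Qed.

Lemma contract_one d y : contract y (ext_one d) = 0.
Proof. by elim: d => //= d IHd; rewrite IHd scaler0 addr0 raddf0 oppr0. Qed.

(** r (k-1) /\ ... /\ r 0, the later rows on the left. *)
Fixpoint wedge_rows (d : nat) (r : nat -> nat -> A) (k : nat) : ext d :=
  if k is k'.+1 then wedge (r k') (wedge_rows d r k') else ext_one d.

Lemma eq_wedge_rows d r r' k : (forall i, (i < k)%N -> r i = r' i) ->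
  wedge_rows d r k = wedge_rows d r' k.
Proof.
elim: k => //= k IHk rr'; rewrite rr' // IHk // => i ik.
by apply/rr'/(leq_trans ik).
Qed.

(** The part of the wedge that contains the last basis vector: Laplace expansion
    along the last column.  With the later rows on the left, the sign of row i
    in the k x k case is exactly that of the cofactor at (i, k-1). *)
Lemma wedge_rowsS d r k :
  wedge_rows d.+1 r k =
  (wedge_rows d r k,
   \sum_(i < k) ((-1) ^+ (i + k.-1) * r i d) *: wedge_rows d (r \o bump i) k.-1).
Proof.
elim: k => [|k IHk]; first by rewrite big_ord0.
rewrite [LHS]/= IHk /=; apply: eq_pair => //=.
rewrite big_ord_recr /= addnn -signr_odd odd_double mul1r addrC.
congr (_ *: _ + _).
  by apply: eq_wedge_rows => i ik; rewrite /= /bump leqNgt ik.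
rewrite linear_sum -sumrN; apply: eq_bigr => i _ /=.
case: k i {IHk} => [|k] i; first by case: i.
rewrite linearZ /= -scaleNr addnS exprS -mulrA mulN1r.
by rewrite /bump -[(i <= k)%N]ltnS ltn_ord.
Qed.

Lemma wedge_rows_gt d r k : (d < k)%N -> wedge_rows d r k = 0.
Proof.
elim: d r k => [|d IHd] r k; first by case: k.
case: k => // k dk; rewrite wedge_rowsS IHd; last exact: ltnW.
by apply: eq_pair => //; rewrite big1 // => i _; rewrite IHd // scaler0.
Qed.

(** [wedge_rowsS] and the cofactor expansion of the determinant along its last
    column are the same recursion. *)
Lemma wedge_rows_det d r :
  wedge_rows d r d = \det (\matrix_(i < d, j < d) r i j) *: ext_top d.
Proof.
elim: d r => [|d IHd] r; first by rewrite det_mx00 scale1r.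
rewrite wedge_rowsS wedge_rows_gt //=; apply: eq_pair => /=; first by rewrite scaler0.
rewrite (expand_det_col _ ord_max) scaler_suml; apply: eq_bigr => i _.
rewrite IHd scalerA mxE /cofactor; congr (_ *: _).
rewrite -mulrA mulrCA; congr (_ * (_ * _)).
congr (\det _); apply/matrixP=> i' j'; rewrite !mxE /= /bump.
by rewrite [(d <= j')%N]leqNgt ltn_ord add0n.
Qed.


(** The submodule J * ext d: all coordinates lie in J. *)
Fixpoint ext_in (J : set A) (d : nat) : ext d -> Prop :=
  if d is d'.+1 then fun w => ext_in J w.1 /\ ext_in J w.2 else J.

Section Coordinatewise.
Variable J : set A.
Hypothesis idJ : is_ideal J.

Lemma ext_in0 d : ext_in J (0 : ext d).
Proof. by elim: d => //=; case: idJ. Qed.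

Lemma ext_inD d (w w' : ext d) : ext_in J w -> ext_in J w' -> ext_in J (w + w').
Proof.
have [_ JD _] := idJ.
elim: d w w' => [|d IHd] /= w w'; first exact: JD.
by move=> [w1 w2] [w'1 w'2]; split; apply: IHd.
Qed.

Lemma ext_inZ d k (w : ext d) : ext_in J w -> ext_in J (k *: w).
Proof.
have [_ _ JM] := idJ.
elim: d w => [|d IHd] /= w; first exact: JM.
by move=> [w1 w2]; split; apply: IHd.
Qed.

Lemma ext_inZr d k (w : ext d) : J k -> ext_in J (k *: w).
Proof.
have [_ _ JM] := idJ; move=> Jk.
elim: d w => [|d IHd] /= w; last by split; apply: IHd.
by rewrite -[_ *: _]/(k * w) mulrC; apply: JM.
Qed.

Lemma ext_inB d (w w' : ext d) : ext_in J w -> ext_in J w' -> ext_in J (w - w').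
Proof.
by move=> Jw Jw'; rewrite -scaleN1r; apply: ext_inD => //; apply: ext_inZ.
Qed.

Lemma ext_in_wedge d c (w : ext d) : ext_in J w -> ext_in J (wedge c w).
Proof.
elim: d w => [|d IHd] /= w; first by case: idJ.
move=> [w1 w2]; split; first exact: IHd.
by apply: ext_inB; [apply: ext_inZ|apply: IHd].
Qed.

Lemma ext_in_contract d y (w : ext d) : ext_in J w -> ext_in J (contract y w).
Proof.
elim: d w => [|d IHd] /= w; first by case: idJ.
move=> [w1 w2]; split; first by apply: ext_inD; [apply: IHd|apply: ext_inZ].
by rewrite -scaleN1r; apply: ext_inZ; apply: IHd.
Qed.

Lemma ext_in_scalar d (w : ext d) : ext_in J w -> J (ext_scalar w).
Proof. by elim: d w => //= d IHd w [/IHd]. Qed.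

Lemma ext_in_nzd d t (w : ext d) : nzd_mod J t -> ext_in J (t *: w) -> ext_in J w.
Proof.
move=> Jt; elim: d w => [|d IHd] /= w; first exact: Jt.
by move=> [/IHd w1 /IHd w2].
Qed.

End Coordinatewise.

Lemma ext_in_adjoin J d t (w : ext d) :
  ext_in (adjoin J t) w -> exists w', ext_in J (w - t *: w').
Proof.
elim: d w => [|d IHd] /= w; first by move=> [r Jr]; exists r.
by move=> [/IHd[u Ju] /IHd[v Jv]]; exists (u, v).
Qed.

Lemma ext_in_sub J J' d (w : ext d) : J `<=` J' -> ext_in J w -> ext_in J' w.
Proof.
move=> JJ'; elim: d w => [|d IHd] /= w; first exact: JJ'.
by move=> [/IHd ? /IHd].
Qed.

Lemma ext_scalarD d (u v : ext d) :
  ext_scalar (u + v) = ext_scalar u + ext_scalar v.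
Proof. by elim: d u v => //= d IHd u v; rewrite IHd. Qed.

Lemma ext_scalarZ d k (u : ext d) : ext_scalar (k *: u) = k * ext_scalar u.
Proof. by elim: d u => //= d IHd u; rewrite IHd. Qed.

Lemma ext_scalar_contract I d y (w : ext d) : is_ideal I ->
  (forall j, (j < d)%N -> I (y j)) -> I (ext_scalar (contract y w)).
Proof.
move=> idI; have [I0 ID IM] := idI.
elim: d w => [|d IHd] //= w Iy.
rewrite ext_scalarD ext_scalarZ; apply: ID; last by rewrite mulrC; apply: IM; apply: Iy.
by apply: IHd => j jd; apply/Iy/ltnW.
Qed.

Lemma ext_scalar_one d : ext_scalar (ext_one d) = 1.
Proof. by elim: d. Qed.

Section Descent.
Variables (d : nat) (r : nat -> nat -> A) (y : nat -> A) (J : set A) (s : seq A).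
Hypotheses (idJ : is_ideal J) (regs : weakly_regular J s) (size_s : size s = d).
Hypothesis sE : forall k, (k < d)%N -> s`_k = \sum_(j < d) r k j * y j.

Let Jk k := foldl (@adjoin A) J (take k s).

Let Jk_ideal k : is_ideal (Jk k).
Proof. exact: foldl_adjoin_ideal. Qed.

Let JkS k : (k < d)%N -> Jk k.+1 = adjoin (Jk k) s`_k.
Proof. by move=> kd; rewrite /Jk (take_nth 0) ?size_s // foldl_rcons. Qed.

(** Each row contracts to an element of s, so the wedge of the first k rows is a
    cycle modulo the first k elements of s. *)
Lemma contract_wedge_rows k : (k <= d)%N ->
  ext_in (Jk k) (contract y (wedge_rows d r k)).
Proof.
elim: k => [|k IHk] kd /=; first by rewrite contract_one; apply: ext_in0.
rewrite contract_wedge -sE // JkS //.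
apply: ext_inB; first exact: adjoin_ideal.
  apply: ext_inZr; first exact: adjoin_ideal.
  exact: adjoin_self.
apply: ext_in_wedge; first exact: adjoin_ideal.
by apply: ext_in_sub (IHk (ltnW kd)); apply: adjoin_sub.
Qed.

(** If b w_k is a boundary modulo (s_0, ..., s_(k-1)), then contracting it and
    cancelling the nonzerodivisor s_(k-1) shows that b w_(k-1) is a boundary
    modulo (s_0, ..., s_(k-2)). *)
Lemma wedge_rows_descent b k : (k <= d)%N ->
  (exists v, ext_in (Jk k) (b *: wedge_rows d r k - contract y v)) ->
  exists v, ext_in J (b *: ext_one d - contract y v).
Proof.
elim: k => [|k IHk] kd [v]; first by rewrite /Jk take0; exists v.
rewrite JkS // => /ext_in_adjoin[u Ju]; apply: IHk; first exact: ltnW.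
exists u; apply: (ext_in_nzd (t := s`_k)).
  by apply: weakly_regular_nth; rewrite ?size_s.
have := ext_in_contract (Jk_ideal k) y Ju.
rewrite !contractB !contractZ contract_contract subr0 /= contract_wedge -sE //.
move=> Jw; have := ext_inD (Jk_ideal k) Jw (ext_inZ (Jk_ideal k) b
  (ext_in_wedge (Jk_ideal k) (r k) (contract_wedge_rows (ltnW kd)))).
by rewrite !scalerBr !scalerA [s`_k * b]mulrC addrAC subrK.
Qed.

End Descent.

(** Extension by 0, to feed families indexed by ordinals to the recursion of
    [ext]. *)
Definition extend (d : nat) (f : 'I_d -> A) (k : nat) : A := oapp f 0 (insub k).

Lemma extendE d (f : 'I_d -> A) (i : 'I_d) : extend f i = f i.
Proof. by rewrite /extend valK. Qed.

(** One half of linkage for a regular sequence inside (y).  J stands for the zero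
    ideal; it is kept general because regular sequences start from the ideal
    generated by the empty list. *)
Lemma regular_det_colon d (C : 'M[A]_d) (y s : 'I_d -> A) b J :
  is_ideal J -> J `<=` ideal_gen (range y) ->
  weakly_regular J (codom s) -> (forall i, s i = \sum_j C i j * y j) ->
  ideal_gen (range s) (\det C * b) -> ideal_gen (range y) b.
Proof.
move=> idJ Jy regs sE sb.
pose r k j := extend (fun i => extend (C i) j) k.
have rE (i j : 'I_d) : r i j = C i j by rewrite /r !extendE.
have size_s : size (codom s) = d by rewrite size_codom card_ord.
have nth_s (i : 'I_d) : (codom s)`_i = s i.
  rewrite (nth_map i) ?size_enum_ord //; congr s; exact: nth_ord_enum.
have srE k : (k < d)%N -> (codom s)`_k = \sum_(j < d) r k j * extend y j.
  move=> kd; rewrite (nth_s (Ordinal kd)) sE; apply: eq_bigr => j _.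
  by rewrite -rE extendE.
have [|v Jv] := wedge_rows_descent idJ regs size_s srE (b := b) (leqnn d).
  exists 0; rewrite raddf0 subr0 wedge_rows_det scalerA take_oversize ?size_s //.
  have idJs : is_ideal (foldl (@adjoin A) J (codom s)) by apply: foldl_adjoin_ideal.
  apply: ext_inZr => //.
  suff <- : \det C = \det (\matrix_(i < d, j < d) r i j).
    rewrite mulrC; apply: ideal_gen_sub sb => // _ [i _ <-].
    by apply: mem_foldl_adjoin; rewrite ?codom_f.
  by congr (\det _); apply/matrixP => i j; rewrite mxE rE.
have [_ yD _] := ideal_gen_ideal (range y).
(* The degree 0 part of a boundary lies in (y). *)
rewrite -[b](subrK (ext_scalar (contract (extend y) v))); apply: yD; last first.
  apply: ext_scalar_contract; first exact: ideal_gen_ideal.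
  move=> j jd; rewrite (extendE y (Ordinal jd)).
  by apply: mem_ideal_gen; exists (Ordinal jd).
apply: Jy; move: Jv => /ext_in_scalar.
by rewrite -scaleN1r ext_scalarD !ext_scalarZ ext_scalar_one mulr1 mulN1r.
Qed.
End Exterior.

(** * The colon property for systems of parameters *)

Lemma is_ideal_scale_preim (A : comPzRingType) (I : set A) u :
  is_ideal I -> is_ideal [set b | I (u * b)].
Proof.
move=> [I0 ID IM]; split => /=.
- by rewrite mulr0.
- by move=> v w Iv Iw; rewrite mulrDr; apply: ID.
- by move=> b v Iv; rewrite mulrCA; apply: IM.
Qed.

Section ParameterColon.
Variables (A : comNzRingType) (d : nat).
Implicit Types (x y z : 'I_d -> A) (I m : set A).

(** Cramer's rule: the adjugate of C writes det(C) y_j in terms of x. *)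
Lemma det_mul_ideal_gen (C : 'M[A]_d) x y b :
  (forall i, x i = \sum_j C i j * y j) ->
  ideal_gen (range y) b -> ideal_gen (range x) (\det C * b).
Proof.
move=> xE; have idx := ideal_gen_ideal (range x).
apply: (ideal_gen_sub (is_ideal_scale_preim (\det C) idx)) => _ [j _ <-] /=.
apply/ideal_gen_rangeP; exists (fun i => (\adj C) j i).
have /matrixP/(_ j 0) : \adj C *m (C *m \col_k y k) = \det C *: \col_k y k.
  by rewrite mulmxA mul_adj_mx mul_scalar_mx.
rewrite !mxE => <-; apply: eq_bigr => i _; congr (_ * _); rewrite xE mxE.
by apply: eq_bigr => k _; rewrite mxE.
Qed.

Lemma uniform_exponent I (x : 'I_d -> A) : is_ideal I ->
  (forall i, exists n, I (x i ^+ n)) -> exists N, forall i, I (x i ^+ N).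
Proof.
move=> [_ _ IM] /fin_all_exists[n In]; exists (\sum_i n i)%N => i.
by rewrite (bigD1 i) //= addnC exprD; apply: IM.
Qed.

(** m is contained in the radical of (z), as for a system of parameters z. *)
Definition radical_ge m z :=
  forall r, m r -> exists n, ideal_gen (range z) (r ^+ n).

(** Some powers of s lie in (z), say s^N = B z, so that s^N = B C y, and by
    Cramer's rule det(B C) b = det(B) det(C) b lies in (s^N). *)
Lemma parameter_det_colon m (s : seq A) (C : 'M[A]_d) y z b :
  regular_sequence s -> [set` s] `<=` m -> size s = d ->
  radical_ge m z -> (forall i, z i = \sum_j C i j * y j) ->
  ideal_gen (range z) (\det C * b) -> ideal_gen (range y) b.
Proof.
move=> regs sm size_s zm zE zb.
pose s' (i : 'I_d) := s`_i.
have [|N sN] := @uniform_exponent (ideal_gen (range z)) s' (ideal_gen_ideal _).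
  by move=> i; apply: zm; apply: sm; rewrite /= mem_nth ?size_s.
have /fin_all_exists[B BE] i := (ideal_gen_rangeP _ _).1 (sN i).
pose D := (\matrix_(i, j) B i j) *m C.
apply: (@regular_det_colon _ _ D y (fun i => s' i ^+ N) b (ideal_gen [set` [::]])).
- exact: ideal_gen_ideal.
- by apply: ideal_gen_sub; first exact: ideal_gen_ideal.
- suff -> : codom (fun i : 'I_d => s' i ^+ N) = [seq t ^+ N | t <- s].
    apply: weakly_regular_exp; first exact: ideal_gen_ideal.
    exact: regular_sequence_weakly.
  apply: (@eq_from_nth _ 0); first by rewrite size_codom card_ord size_map.
  rewrite size_codom card_ord => i id.
  rewrite [RHS](nth_map 0) ?size_s //.
  by rewrite (nth_map (Ordinal id)) ?size_enum_ord // /s' nth_enum_ord.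
- move=> i; rewrite BE.
  under eq_bigr do rewrite zE mulr_sumr.
  rewrite exchange_big; apply: eq_bigr => k _; rewrite mxE mulr_suml.
  by apply: eq_bigr => j _; rewrite mxE mulrA.
- rewrite det_mulmx -mulrA; apply: (det_mul_ideal_gen (y := z)) => // i.
  by rewrite BE; apply: eq_bigr => j _; rewrite mxE.
Qed.

End ParameterColon.

(** * Frobenius powers of ideals *)

Section Frobenius.
Variables (A : comNzRingType) (p : nat).
Hypothesis charAp : p \in [pchar A].

Lemma expr_frobD e (u v : A) : (u + v) ^+ (p ^ e) = u ^+ (p ^ e) + v ^+ (p ^ e).
Proof.
apply: exprDn_pchar.
by rewrite pnatX (pnatE _ (pcharf_prime charAp)) charAp.
Qed.

Lemma expr_frob0 e : (0 : A) ^+ (p ^ e) = 0.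
Proof. by rewrite expr0n expn_eq0 eqn0Ngt prime_gt0 // (pcharf_prime charAp). Qed.

Lemma expr_frob_sum e (n : nat) (f : 'I_n -> A) :
  (\sum_i f i) ^+ (p ^ e) = \sum_i f i ^+ (p ^ e).
Proof.
by apply: (big_morph (fun u : A => u ^+ (p ^ e))); [apply: expr_frobD|apply: expr_frob0].
Qed.

Lemma det_frob e (d : nat) (C : 'M[A]_d) :
  \det (map_mx (fun u => u ^+ (p ^ e)) C) = \det C ^+ (p ^ e).
Proof.
elim: e => [|e IHe].
  by congr (\det _); apply/matrixP=> i j; rewrite mxE.
rewrite expnSr exprM -IHe -[RHS](pFrobenius_autE charAp) -det_map_mx.
by congr (\det _); apply/matrixP=> i j; rewrite !mxE /= pFrobenius_autE -exprM.
Qed.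

Lemma frobenius_power_range e (d : nat) (x : 'I_d -> A) :
  frobenius_power (ideal_gen (range x)) (p ^ e) =
  ideal_gen (range (fun i => x i ^+ (p ^ e))).
Proof.
apply/seteqP; split; apply: ideal_gen_sub; try exact: ideal_gen_ideal.
  move=> _ [r /ideal_gen_rangeP[c ->] <-]; apply/ideal_gen_rangeP.
  exists (fun i => c i ^+ (p ^ e)).
  by rewrite expr_frob_sum; apply: eq_bigr => i _; rewrite exprMn.
move=> _ [i _ <-]; apply: mem_ideal_gen; exists (x i) => //.
by apply: mem_ideal_gen; exists i.
Qed.

Lemma ideal_gen_exp_le (d : nat) (x : 'I_d -> A) n k : (n <= k)%N ->
  ideal_gen (range (fun i => x i ^+ k)) `<=`
  ideal_gen (range (fun i => x i ^+ n)).
Proof.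
move=> nk; apply: ideal_gen_sub; first exact: ideal_gen_ideal.
move=> _ [i _ <-]; rewrite -(subnK nk) exprD.
have [_ _ IM] := ideal_gen_ideal (range (fun i => x i ^+ n)); apply: IM.
by apply: mem_ideal_gen; exists i.
Qed.

(** If r^k lies in (x), then r^(k q) lies in (x_1^q, ..., x_d^q) for a Frobenius
    power q = p^n, and q >= n. *)
Lemma radical_ge_exp (m : set A) (d : nat) (x : 'I_d -> A) n :
  radical_ge m x -> radical_ge m (fun i => x i ^+ n).
Proof.
move=> xm r /xm[k xr]; exists (k * p ^ n)%N.
apply: (@ideal_gen_exp_le _ _ _ (p ^ n)).
  by apply/ltnW/ltn_expl/prime_gt1/(pcharf_prime charAp).
rewrite -frobenius_power_range exprM; apply: mem_ideal_gen.
by exists (r ^+ k).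
Qed.

End Frobenius.

(** * Fractions in top local cohomology *)

Section CechFractions.
Variables (A : comNzRingType) (d : nat) (x : 'I_d -> A).
Let X := \prod_i x i.

Let prod_face i : X = x i * \prod_(j | j != i) x j.
Proof. exact: bigD1. Qed.

Lemma powers_exp n : mulset_set (powers X) (X ^+ n).
Proof. by exists n. Qed.

Definition cech_frac b n : cech_top x := Defs.frac b (mkden (powers_exp n)).

Lemma cech_fracP (u : cech_top x) : exists b n, u = cech_frac b n.+1.
Proof.
have [b [s ->]] := fracE u; have [n _ sE] := mulset_val s.
exists (b * X), n; apply: frac_eq => /=.
by rewrite -sE exprS mulrA.
Qed.

Lemma cech_fracX b n q : cech_frac b n ^+ q = cech_frac (b ^+ q) (n * q).
Proof.
elim: q => [|q IHq].
  by apply: frac_eq; rewrite /= muln0 !expr0.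
rewrite exprS IHq; apply: (etrans (loc_mulE _ _ _ _)).
by apply: frac_eq; rewrite /= -exprS mulnS exprD.
Qed.

Lemma cech_fracZ c b n : c *: cech_frac b n = cech_frac (c * b) n.
Proof.
apply: (etrans (loc_mulE _ _ _ _)).
by apply: frac_eq; rewrite /= mul1r.
Qed.

Lemma cech_fracZX k b n :
  X ^+ (n + k) *: cech_frac b n = loc_map (powers X) (X ^+ k * b).
Proof. by rewrite cech_fracZ; apply: frac_eq => /=; rewrite exprD; ring. Qed.

Lemma cech_frac0 n : cech_frac 0 n = 0.
Proof. by apply: frac_eq; rewrite /= !mul0r. Qed.

Lemma cech_fracD b c n : cech_frac (b + c) n = cech_frac b n + cech_frac c n.
Proof.
apply/esym/(etrans (loc_addE _ _ _ _)).
by apply: frac_eq => /=; ring.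
Qed.

(** x_i^n / (x_1...x_d)^n has only the other x_j in its denominator. *)
Lemma cech_boundary_frac b n :
  ideal_gen (range (fun i => x i ^+ n)) b -> cech_boundary (cech_frac b n).
Proof.
move=> /ideal_gen_rangeP[c ->]; exists (fun i => cech_frac (c i * x i ^+ n) n).
split; last first.
  exact: (big_morph (fun b => cech_frac b n) (fun b c => cech_fracD b c n) (cech_frac0 n)).
move=> i; exists n, (c i); rewrite cech_fracZ; apply: frac_eq => /=.
by rewrite mulr1 (prod_face i) exprMn; ring.
Qed.

(** Clearing denominators in a sum of fractions whose i-th term has no x_i in its
    denominator leaves a multiple of a power of x_i in that term. *)
Lemma cech_boundary_frac_inv b n : cech_boundary (cech_frac b n) ->
  exists k, ideal_gen (range (fun i => x i ^+ (n + k))) (X ^+ k * b).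
Proof.
move=> [v [/fin_all_exists[h /fin_all_exists[c vE]] bE]].
pose k := (\sum_i h i)%N; pose f i := \prod_(j | j != i) x j.
(* The common denominator (x_1...x_d)^(n+k) is divisible by that of every term. *)
pose S := \sum_i f i ^+ (n + k - h i) * c i * x i ^+ (n + k).
have : loc_map (powers X) (X ^+ k * b) = loc_map (powers X) S.
  rewrite -(cech_fracZX k b n) bE scaler_sumr raddf_sum; apply: eq_bigr => i _.
  have hik : (h i <= n + k)%N by rewrite /k (bigD1 i) //= addnCA leq_addr.
  have XE : X ^+ (n + k) = x i ^+ (n + k) * f i ^+ (n + k - h i) * f i ^+ h i.
    by rewrite -mulrA -exprD subnK // -exprMn -prod_face.
  rewrite XE -scalerA vE -[LHS]/(loc_map _ _ * _) -rmorphM; congr loc_map.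
  by rewrite -[LHS]mulrA [LHS]mulrC.
move=> /fracP[_ [l _ <-]] /=; rewrite !mulr1 => SE.
exists (k + l)%N; rewrite [X in ideal_gen _ X](_ : _ = X ^+ l * S); last first.
  by rewrite -SE mulrA -exprD addnC.
rewrite /S mulr_sumr.
apply/ideal_gen_rangeP.
exists (fun i => f i ^+ l * (f i ^+ (n + k - h i) * c i)); apply: eq_bigr => i _.
rewrite (prod_face i) -/(f i) exprMn addnA [x i ^+ (_ + l)]exprD.
ring.
Qed.

End CechFractions.

Section CohenMacaulay.
Variables (A : comNzRingType) (m : set A) (d p : nat) (s : seq A) (x : 'I_d -> A).
Hypothesis charAp : p \in [pchar A].
Hypotheses (regs : regular_sequence s) (sm : [set` s] `<=` m).
Hypothesis size_s : size s = d.
Hypothesis xm : radical_ge m x.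

(** The maps of the direct system A/(x^n) -> A/(x^(n+k)), multiplication by
    (x_1...x_d)^k, are injective: this power is the determinant of the diagonal
    matrix taking x^n to x^(n+k). *)
Lemma cech_class_frac0 b n :
  cech_class (cech_frac x b n) = 0 <-> ideal_gen (range (fun i => x i ^+ n)) b.
Proof.
have E : cech_class (cech_frac x b n) = 0 <-> cech_boundary (cech_frac x b n).
  by rewrite -{2}[cech_frac x b n]subr0 -cech_classP raddf0.
rewrite E; split; last exact: cech_boundary_frac.
move=> /cech_boundary_frac_inv[k xb].
apply: (parameter_det_colon (C := diag_mx (\row_i x i ^+ k))) regs sm size_s _ _ _.
- exact: (radical_ge_exp charAp (n + k)%N xm).
- move=> i; rewrite (bigD1 i) //= big1 ?addr0 => [|j /negPf ji].
    by rewrite !mxE eqxx mulr1n addnC exprD.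
  by rewrite !mxE eq_sym ji mul0r.
- rewrite det_diag; under eq_bigr do rewrite mxE.
  by rewrite prodrXl.
Qed.

Lemma iter_loccoh_frob b n e :
  iter e (loccoh_frob p) (cech_class (cech_frac x b n)) =
  cech_class (cech_frac x (b ^+ (p ^ e)) (n * p ^ e)).
Proof.
elim: e => [|e IHe]; first by rewrite muln1.
by rewrite iterS IHe loccoh_frobE // cech_fracX -exprM -mulnA -expnSr.
Qed.

(** Frobenius raises the entries of C and its determinant to the q-th power, so
    [parameter_det_colon] applies to y^q and x^(nq). *)
Lemma frobenius_power_frac (y : 'I_d -> A) n (C : 'M[A]_d) e b c :
  (forall i, x i ^+ n = \sum_j C i j * y j) ->
  frobenius_power (ideal_gen (range y)) (p ^ e) (c * b ^+ (p ^ e)) <->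
  c *: iter e (loccoh_frob p) (cech_class (cech_frac x (\det C * b) n)) = 0.
Proof.
move=> xE; rewrite iter_loccoh_frob -cech_classZ cech_fracZ cech_class_frac0.
rewrite frobenius_power_range // exprMn -(det_frob charAp) mulrCA.
have xqE i : x i ^+ (n * p ^ e) =
    \sum_j (map_mx (fun u => u ^+ (p ^ e)) C) i j * y j ^+ (p ^ e).
  rewrite exprM xE expr_frob_sum //.
  by apply: eq_bigr => j _; rewrite mxE exprMn.
split; first exact: det_mul_ideal_gen.
apply: parameter_det_colon regs sm size_s _ xqE.
exact: (radical_ge_exp charAp (n * p ^ e)%N xm).
Qed.

End CohenMacaulay.

(** * Comparison of the closures *)

Section Closures.
Variables (K : realType) (R : idomainType) (m : set R) (d p : nat) (s : seq R).
Variables (x y : 'I_d -> R) (n : nat) (C : 'M[R]_d) (a : set R) (t : K).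
Hypothesis charRp : p \in [pchar R].
Hypotheses (regs : regular_sequence s) (sm : [set` s] `<=` m).
Hypothesis size_s : size s = d.
Hypothesis xm : radical_ge m x.
Hypothesis xE : forall i, x i ^+ n = \sum_j C i j * y j.

Lemma tight_closure_frac b : tight_closure p a t (ideal_gen (range y)) b <->
  loccoh_tight_closure0 p x a t (cech_class (cech_frac x (\det C * b) n)).
Proof.
split=> -[c c0 [e0 ce]]; exists c => //; exists e0 => e ee0 z az.
  apply/(frobenius_power_frac charRp regs sm size_s xm _ _ _ xE).
  by rewrite mulrAC; apply: ce.
rewrite mulrAC; apply/(frobenius_power_frac charRp regs sm size_s xm _ _ _ xE).
exact: ce.
Qed.

Lemma frobenius_closure_frac b : frobenius_closure p (ideal_gen (range y)) b <->
  loccoh_frobenius_closure0 p x (cech_class (cech_frac x (\det C * b) n)).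
Proof.
split=> -[e be]; exists e.
  rewrite -[iter _ _ _]scale1r.
  apply/(frobenius_power_frac charRp regs sm size_s xm _ _ _ xE).
  by rewrite mul1r.
rewrite -[_ ^+ _]mul1r.
apply/(frobenius_power_frac charRp regs sm size_s xm _ _ _ xE).
by rewrite scale1r.
Qed.

End Closures.

Local Close Scope classical_set_scope.

Theorem theorem5p16 (K : realType) (R : idomainType) (m : set R) (p d : nat)
    (a : set R) (t : K)
    (m_local : local_ring m) (R_excellent : excellent R)
    (R_cm : cohen_macaulay m) (R_char : p \in [pchar R])
    (R_dim : krull_dim R d)
    (a_ideal : is_ideal a) (a_height : height_ge a 1) (t_gt0 : 0 < t)
    (x : 'I_d -> R) (x_sop : system_of_parameters m x) :
  F_nilpotent p m a t <->
  loccoh_tight_closure0 p x a t = loccoh_frobenius_closure0 p x.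
Proof.
have dim_uniq k : krull_dim R k -> k = d.
  move=> [[C Ck] kmax]; have [[D Dd] dmax] := R_dim.
  by apply/eqP; rewrite eqn_leq (dmax _ _ Ck) (kmax _ _ Dd).
have [d' [/dim_uniq-> [[s [regs sm size_s]] _]]] := R_cm.
have [_ x_in_m xm] := x_sop.
split=> [nilp|loccohE].
  apply/seteqP; apply/seteqP/predeqP => xi.
  have [b [n ->]] : exists b n, xi = cech_class (cech_frac x b n.+1).
    have [b [n xiE]] := cech_fracP (repr xi).
    by exists b, n; rewrite -xiE cech_classK.
  (* The parameter ideal of x^(n+1) itself, with the identity matrix. *)
  have xE i : x i ^+ n.+1 = \sum_j (1%:M : 'M_d) i j * x j ^+ n.+1.
    rewrite (bigD1 i) //= big1 ?addr0 => [|j /negPf ji]; rewrite mxE ?eqxx ?mul1r //.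
    by rewrite eq_sym ji mul0r.
  have xn_sop : system_of_parameters m (fun i => x i ^+ n.+1).
    split=> // [i|]; last exact: (radical_ge_exp R_char n.+1 xm).
    have [[[_ _ mM] _ _] _] := m_local.
    by rewrite exprSr; apply: mM; apply: x_in_m.
  rewrite -[b]mul1r -(det1 R d).
  rewrite -(tight_closure_frac _ _ R_char regs sm size_s xm xE).
  rewrite -(frobenius_closure_frac R_char regs sm size_s xm xE).
  by rewrite nilp.
move=> d'' y y_sop; have [ydim _ _] := y_sop.
move: (dim_uniq _ ydim) => d''E; subst d''.
have [_ _ ym] := y_sop.
have [|n xn] := @uniform_exponent _ _ (ideal_gen (range y)) x (ideal_gen_ideal _).
  by move=> i; apply: ym.
have /fin_all_exists[c xE] i := (ideal_gen_rangeP _ _).1 (xn i).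
have {}xE i : x i ^+ n = \sum_j (\matrix_(i, j) c i j) i j * y j.
  by rewrite xE; apply: eq_bigr => j _; rewrite mxE.
apply/predeqP => b.
rewrite (tight_closure_frac _ _ R_char regs sm size_s xm xE).
by rewrite (frobenius_closure_frac R_char regs sm size_s xm xE) loccohE.
Qed.
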